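(* Let $G$ and $G^*$ be graphs on the same vertex set $V=\{v_1,\dots,v_n\}$ with adjacency matrices $A$ and $A^*$, and let $S,S^*\subseteq V$ be non-empty. Write $W=W^S_G$ and $W^*=W^{S^*}_{G^*}$, and let $r={\rm rank}(W)$. (i) If $r<n$ and $W_{[0,r]}=W^*_{[0,r]}$, then $W=W^*$, the set of main eigenvalues of $S$ in $G$ equals the set of main eigenvalues of $S^*$ in $G^*$, and for each such main eigenvalue $\mu$ the main eigenvector of $S$ in $G$ for $\mu$ equals the main eigenvector of $S^*$ in $G^*$ for $\mu$. (ii) If $r=n$ and $W=W^*$, then the set of main eigenvalues of $S$ in $G$ equals that of $S^*$ in $G^*$, and for each such main eigenvalue $\mu$ the corresponding main eigenvectors coincide. (In the paper's terminology: if $r<n$ then $W^S_{[0,r]}$ determines $W^S$, the main eigenvalues and the main eigenvectors of $S$; if $r=n$ then $W^S$ determines the main eigenvalues and main eigenvectors of $S$.)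
   Context: Graphs are finite, simple, undirected. For a graph $G$ with vertex set $V=\{v_1,\dots,v_n\}$, adjacency matrix $A$, and non-empty $S\subseteq V$ with characteristic vector ${\rm e}\in\{0,1\}^n$: $W^S_{[i,j]}=[A^i{\rm e},\dots,A^j{\rm e}]$ for $0\le i\le j$, and the walk matrix is $W^S_G=W^S_{[0,n-1]}$. Since $A$ is real symmetric, ${\rm e}$ is uniquely ${\rm e}={\rm e}_1+\dots+{\rm e}_r$ with nonzero eigenvectors ${\rm e}_k$ of $A$ for pairwise distinct eigenvalues $\mu_k$; the $\mu_k$ are the main eigenvalues and ${\rm e}_k$ the main eigenvector for $\mu_k$ (for $S$ in $G$). *)

(* Defs.v *)
From mathcomp Require Import all_boot all_order all_algebra.
From mathcomp Require Import reals.

Set Implicit Arguments.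
Unset Strict Implicit.
Unset Printing Implicit Defensive.

Import GRing.Theory.
Local Open Scope ring_scope.

Record sgraph (n : nat) := SGraph {
  adj : rel 'I_n;
  adj_sym : symmetric adj;
  adj_irr : irreflexive adj
}.

Definition adjmx (R : realType) (n : nat) (G : sgraph n) : 'M[R]_n :=
  \matrix_(i, j) (adj G i j)%:R.

Definition charvec (R : realType) (n : nat) (S : {set 'I_n}) : 'cV[R]_n :=
  \col_i (i \in S)%:R.

(* W^S_[i,j] for i <= j: column k is A^(i+k) e, for k = 0, ..., j - i. *)
Definition walk_block (R : realType) (n : nat) (G : sgraph n) (S : {set 'I_n})
    (i j : nat) : 'M[R]_(n, (j - i).+1) :=
  \matrix_(u, k) (adjmx R G ^+ (i + k) *m charvec R S) u 0.

(* For n > 0 this is the square matrix [e, A e, ..., A^(n-1) e]; its number of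
   columns is written (n.-1 - 0).+1.  The case n = 0 is irrelevant, since S is
   always assumed to be non-empty. *)
Definition walk_matrix (R : realType) (n : nat) (G : sgraph n)
    (S : {set 'I_n}) : 'M[R]_(n, (n.-1 - 0).+1) :=
  walk_block R G S 0 n.-1.

(* Since A is real symmetric such a decomposition exists, and it is unique up
   to the order of its terms. *)
Definition main_decomposition (R : realType) (n : nat) (G : sgraph n)
    (S : {set 'I_n}) (m : nat) (mu : 'I_m -> R) (v : 'I_m -> 'cV[R]_n) : Prop :=
  [/\ injective mu,
      forall k, v k != 0,
      forall k, adjmx R G *m v k = mu k *: v k
    & charvec R S = \sum_(k < m) v k].

Definition main_eigenvector (R : realType) (n : nat) (G : sgraph n)
    (S : {set 'I_n}) (x : R) (w : 'cV[R]_n) : Prop :=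
  exists (m : nat) (mu : 'I_m -> R) (v : 'I_m -> 'cV[R]_n),
    main_decomposition G S mu v /\ exists k : 'I_m, mu k = x /\ v k = w.

Definition main_eigenvalue (R : realType) (n : nat) (G : sgraph n)
    (S : {set 'I_n}) (x : R) : Prop :=
  exists w : 'cV[R]_n, main_eigenvector G S x w.

(* Any two main eigenvectors for the same main eigenvalue are compared, so no
   choice of a representative is involved. *)
Definition same_main_eigen (R : realType) (n : nat) (G : sgraph n)
    (S : {set 'I_n}) (G' : sgraph n) (S' : {set 'I_n}) : Prop :=
  (forall x : R, main_eigenvalue G S x <-> main_eigenvalue G' S' x) /\
  (forall x : R, main_eigenvalue G S x ->
     forall w w' : 'cV[R]_n,
       main_eigenvector G S x w -> main_eigenvector G' S' x w' -> w = w').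

(* Main.v *)
Require Import Defs.
From mathcomp Require Import all_boot all_order all_algebra.
From mathcomp Require Import reals.

(** A main eigenvector is a polynomial in [A] applied to [e], so everything is
    determined by the sequence of all [A^k e].  If [r < n], the [r + 1] vectors
    [e, ..., A^r e] are dependent, which gives a nonzero polynomial of degree
    at most [r] that annihilates [e] under [A] and under [A*]; reducing
    [X^k] modulo it shows that [A^k e = A*^k e*] for all [k].  If [r = n], the
    matrix [A - A*] kills all columns of [W] but the last one, so it has rank at
    most 1; being symmetric with zero diagonal, it vanishes. *)

Set Implicit Arguments.
Unset Strict Implicit.
Unset Printing Implicit Defensive.

Import GRing.Theory.
Local Open Scope ring_scope.

Section Krylov.
Variables (F : fieldType) (n : nat).
Implicit Types (A B : 'M[F]_n.+1) (e f v w : 'cV[F]_n.+1) (p q : {poly F}).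

Lemma horner_mx_mulmxE A e q :
  horner_mx A q *m e = \sum_(i < size q) q`_i *: (A ^+ i *m e).
Proof.
rewrite -[q in LHS]coefK poly_def raddf_sum /= mulmx_suml.
apply: eq_bigr => i _.
by rewrite linearZ /= rmorphXn /= horner_mx_X -scalemxAl.
Qed.

Lemma horner_mx_eigen A v x q :
  A *m v = x *: v -> horner_mx A q *m v = q.[x] *: v.
Proof.
move=> Av; rewrite horner_mx_mulmxE horner_coef scaler_suml.
apply: eq_bigr => i _; rewrite -scalerA; congr (_ *: _).
elim: {i}(nat_of_ord i) => [|i IHi]; first by rewrite !expr0 mul1mx scale1r.
by rewrite exprSr -[_ * A]/(_ *m A) -mulmxA Av -scalemxAr IHi scalerA -exprS.
Qed.

Lemma eq_horner_mx_size A B e f r q :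
    (forall i, (i < r)%N -> A ^+ i *m e = B ^+ i *m f) -> (size q <= r)%N ->
  horner_mx A q *m e = horner_mx B q *m f.
Proof.
move=> eqAB le_q; rewrite !horner_mx_mulmxE; apply: eq_bigr => i _.
by rewrite eqAB // (leq_trans (ltn_ord i)).
Qed.

Lemma eq_krylov_annihilator A B e f r p :
    p != 0 -> (size p <= r.+1)%N -> horner_mx A p *m e = 0 ->
    (forall i, (i <= r)%N -> A ^+ i *m e = B ^+ i *m f) ->
  forall i, A ^+ i *m e = B ^+ i *m f.
Proof.
move=> p0 le_p pAe eqAB i.
(* [p] involves only powers up to [r], where both sequences agree, so it also annihilates [f] under
   [B]. *)
have pBf : horner_mx B p *m f = 0 by rewrite -(@eq_horner_mx_size A B e f r.+1).
have red C g : horner_mx C p *m g = 0 ->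
    C ^+ i *m g = horner_mx C ('X^i %% p) *m g.
  move=> pCg; rewrite -{1}(horner_mx_X C) -rmorphXn /= {1}(divp_eq 'X^i p).
  by rewrite rmorphD rmorphM /= mulmxDl -mulmxA pCg mulmx0 add0r.
rewrite !red //; apply: (@eq_horner_mx_size _ _ _ _ r.+1) => //.
by apply: leq_trans le_p; rewrite ltnW // ltn_modp.
Qed.

(** Rank at most [r] makes the [r.+1] columns dependent; the coefficients [c] of a linear relation
    among them, read as a polynomial through [rVpoly], give [p]. *)
Lemma krylov_annihilator A e r :
    (\rank (\matrix_(u < n.+1, k < r.+1) (A ^+ k *m e) u 0)%R <= r)%N ->
  exists p, [/\ p != 0, (size p <= r.+1)%N & horner_mx A p *m e = 0].
Proof.
set W := \matrix_(u, k) _ => rkW.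
have /rowV0Pn[c /sub_kermxP cW c0] : kermx W^T != 0.
  by rewrite kermx_eq0 /row_free mxrank_tr neq_ltn ltnS rkW.
exists (rVpoly c); split; last 1 first.
- apply/matrixP => u j; rewrite ord1 [RHS]mxE.
  have /matrixP/(_ 0 u) := cW; rewrite mxE [RHS]mxE => <-.
  rewrite [rVpoly c]poly_def raddf_sum /= mulmx_suml summxE.
  apply: eq_bigr => i _; rewrite linearZ /= rmorphXn /= horner_mx_X.
  by rewrite -scalemxAl !mxE insubT //= => lt_i; congr (c 0 _ * _); apply: val_inj.
- by apply: contraNneq c0 => pc0; rewrite -[c]rVpolyK pc0 linear0.
- exact: size_poly.
Qed.

(** All 2 by 2 minors of an outer product vanish, so by symmetry the square of [D i j] is
    [D i i * D j j], which is 0. *)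
Lemma symmetric_rank1_zero_diag m (D : 'M[F]_m) (a b : 'I_m -> F) :
    (forall i j, D i j = D j i) -> (forall i, D i i = 0) ->
    (forall i j, D i j = a i * b j) -> D = 0.
Proof.
move=> symD diagD DE; apply/matrixP => i j; rewrite [RHS]mxE; apply/eqP.
have : D i j * D j i = D i i * D j j by rewrite !DE mulrACA [b j * _]mulrC mulrACA.
by rewrite !diagD mulr0 symD => /eqP; rewrite mulf_eq0 orbb.
Qed.

End Krylov.

Section MainEigen.
Variables (R : realType) (n : nat).
Implicit Types (G : sgraph n.+1) (S : {set 'I_n.+1}) (x : R) (w : 'cV[R]_n.+1).

Lemma horner_mx_decomposition G S m (mu : 'I_m -> R) (v : 'I_m -> 'cV[R]_n.+1) q :
    main_decomposition G S mu v ->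
  horner_mx (adjmx R G) q *m charvec R S = \sum_(k < m) q.[mu k] *: v k.
Proof.
move=> [_ _ eig ->]; rewrite mulmx_sumr; apply: eq_bigr => k _.
exact: horner_mx_eigen.
Qed.

(* The polynomial [p] selects the component of [x] and, through the factor [q],
   can be made to do so for two decompositions at once. *)
Lemma main_eigenvector_poly G S x w : main_eigenvector G S x w ->
  exists2 p : {poly R}, p.[x] != 0 &
    forall q, horner_mx (adjmx R G) (p * q) *m charvec R S = (p * q).[x] *: w.
Proof.
move=> [m [mu [v [dec [k [<- <-]]]]]].
exists (\prod_(j < m | j != k) ('X - (mu j)%:P)).
  rewrite horner_prod; apply/prodf_neq0 => j jk.
  rewrite hornerXsubC subr_eq0; apply: contraNneq jk => eq_mu.
  by case: dec => inj _ _ _; rewrite (inj _ _ eq_mu).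
move=> q; rewrite (horner_mx_decomposition _ dec) (bigD1 k) //= [X in _ + X]big1 ?addr0 //.
move=> j jk; rewrite (bigD1 j) //= !hornerM hornerXsubC subrr !mul0r.
by rewrite scale0r.
Qed.

(** With [p] and [q] selecting [w] and [w'], the polynomial [p * q = q * p] sends the characteristic
    vector to the same nonzero multiple of both. *)
Lemma main_eigenvector_uniq G S x w w' :
  main_eigenvector G S x w -> main_eigenvector G S x w' -> w = w'.
Proof.
move=> /main_eigenvector_poly[p px pE] /main_eigenvector_poly[q qx qE].
have pqx : (p * q).[x] != 0 by rewrite hornerM mulf_neq0.
by apply: (scalerI pqx); rewrite -pE mulrC qE.
Qed.

Lemma main_eigenvector_transfer G G' S S' x w :
    (forall i, adjmx R G ^+ i *m charvec R S = adjmx R G' ^+ i *m charvec R S') ->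
  main_eigenvector G S x w -> main_eigenvector G' S' x w.
Proof.
move=> eqG [m [mu [v [dec [k vk]]]]].
have eqH q : horner_mx (adjmx R G) q *m charvec R S =
    horner_mx (adjmx R G') q *m charvec R S'.
  by apply: (@eq_horner_mx_size _ _ _ _ _ _ (size q)).
exists m, mu, v; split; last by exists k.
have eqe : charvec R S' = charvec R S.
  by have := eqG 0%N; rewrite !expr0 !mul1mx.
case: (dec) => inj nz eig sum; split=> // [j|]; last by rewrite eqe.
have /main_eigenvector_poly[p px pE] : main_eigenvector G S (mu j) (v j).
  by exists m, mu, v; split=> //; exists j.
(* Up to the nonzero factor [p.[mu j]], [v j] is [p] of either adjacency matrix applied to the
   characteristic vector; one more application of the matrix turns [p] into ['X * p], on which both
   graphs agree again. *)
apply: (scalerI px); rewrite -eig !scalemxAr.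
have := pE 1; rewrite mulr1 => <-.
rewrite {1}eqH !mulmxA -{1}(horner_mx_X (adjmx R G')) -{1}(horner_mx_X (adjmx R G)).
by rewrite -![horner_mx _ 'X *m _]/(_ * _) -!rmorphM eqH.
Qed.

Lemma eq_krylov_same_main_eigen G G' S S' :
    (forall i, adjmx R G ^+ i *m charvec R S = adjmx R G' ^+ i *m charvec R S') ->
  same_main_eigen R G S G' S'.
Proof.
move=> eqG; split=> [x|x _ w w' /(main_eigenvector_transfer eqG)].
  by split=> -[w wE]; exists w; apply: main_eigenvector_transfer wE.
exact: main_eigenvector_uniq.
Qed.

Lemma walk_block_col G G' S S' r :
    walk_block R G S 0 r = walk_block R G' S' 0 r ->
  forall i, (i <= r)%N ->
    adjmx R G ^+ i *m charvec R S = adjmx R G' ^+ i *m charvec R S'.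
Proof.
move=> /matrixP eqW i le_ir; apply/matrixP => u j; rewrite ord1.
have lt_i : (i < (r - 0).+1)%N by rewrite subn0.
by have := eqW u (Ordinal lt_i); rewrite !mxE.
Qed.

Lemma rank_walk_block G S r : (r <= n)%N ->
  (\rank (\matrix_(u < n.+1, k < r.+1) (adjmx R G ^+ k *m charvec R S) u 0)%R
    <= \rank (walk_matrix R G S))%N.
Proof.
move=> le_rn; have le_r : (r.+1 <= (n.+1.-1 - 0).+1)%N by rewrite subn0.
set B := (B in (\rank B <= _)%N).
have -> : B = walk_matrix R G S *m colsub (widen_ord le_r) 1%:M.
  rewrite mulmx_colsub mulmx1; apply/matrixP => u k.
  by rewrite !mxE.
exact: mxrankM_maxl.
Qed.

Lemma full_rank_walk_adjmx_eq G G' S S' :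
    \rank (walk_matrix R G S) = n.+1 ->
    walk_matrix R G S = walk_matrix R G' S' ->
  adjmx R G = adjmx R G'.
Proof.
move=> rkW eqW; have eqG := walk_block_col eqW.
set W := walk_matrix R G S in rkW *; set D := adjmx R G - adjmx R G'.
(* The column count of [W] equals [n.+1] only up to a rewrite, so [W] is not typed as square; full
   row rank still makes [pinvmx W] a right inverse. *)
have /mulmxVp WV : row_free W by rewrite /row_free rkW.
(* Multiplying column [k] by either adjacency matrix gives column [k.+1] of the common walk matrix,
   which exists only for [k < n]. *)
have DW u (k : 'I_(n.+1.-1 - 0).+1) : (k < n)%N -> (D *m W) u k = 0.
  move=> lt_k.
  have -> : (D *m W) u k = (D *m (adjmx R G ^+ k *m charvec R S)) u 0.
    by rewrite !mxE; apply: eq_bigr => j _; rewrite !mxE.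
  have step (B : 'M[R]_n.+1) e : B *m (B ^+ k *m e) = B ^+ k.+1 *m e.
    by rewrite mulmxA exprS.
  rewrite mulmxBl step eqG // eqG; last exact: ltnW.
  by rewrite step subrr mxE.
apply/eqP; rewrite -subr_eq0; apply/eqP.
(* [D] is [D *m W *m pinvmx W], and only the last column of [D *m W] survives: [D] is that column
   times the last row of [pinvmx W]. *)
apply: (@symmetric_rank1_zero_diag _ _ _ (fun i => (D *m W) i ord_max)
          (fun j => pinvmx W ord_max j)) => [i j|i|i j].
- by rewrite !mxE ![adj _ j i]adj_sym.
- by rewrite !mxE !adj_irr subrr.
rewrite -/D -[D in LHS]mulmx1 -WV mulmxA mxE (bigD1 ord_max) //= big1 ?addr0 //.
move=> k k_max; rewrite DW ?mul0r //.
have : (k <= n)%N by rewrite -ltnS (leq_trans (ltn_ord k)) // subn0.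
rewrite leq_eqVlt => /orP[/eqP kn|//].
by case/eqP: k_max; apply: val_inj; rewrite /= kn subn0.
Qed.

End MainEigen.

Theorem theorem4p2 (R : realType) (n : nat) (G G' : sgraph n)
    (S S' : {set 'I_n}) (hS : S != set0) (hS' : S' != set0)
    (r : nat) (hr : r = (\rank (walk_matrix R G S))%N) :
  ((r < n)%N -> walk_block R G S 0 r = walk_block R G' S' 0 r ->
     walk_matrix R G S = walk_matrix R G' S' /\ same_main_eigen R G S G' S')
  /\
  (r = n -> walk_matrix R G S = walk_matrix R G' S' ->
     same_main_eigen R G S G' S').
Proof.
case: n => [|n] in G G' S S' hS hS' hr *.
  by case/set0Pn: hS => -[].
split=> [lt_rn eqB|rn eqW]; last first.
  have eqA := full_rank_walk_adjmx_eq (etrans (esym hr) rn) eqW.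
  have eqe := walk_block_col eqW (leq0n _); rewrite !expr0 !mul1mx in eqe.
  by apply: eq_krylov_same_main_eigen => i; rewrite eqA eqe.
(* As [r] is less than the number of columns, the first [r.+1] columns all lie in the walk matrix,
   so their rank is at most [r]. *)
have rkB := rank_walk_block R G S lt_rn; rewrite -hr in rkB.
have [p [p0 le_p pAe]] := krylov_annihilator rkB.
have eqG := eq_krylov_annihilator p0 le_p pAe (walk_block_col eqB).
split; last exact: eq_krylov_same_main_eigen.
by apply/matrixP => u k; rewrite mxE [RHS]mxE eqG.
Qed.
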